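(* Let $\tau>0$ and let $A_0,A_1\in\mathbb{R}^{n\times n}$ be such that the time-delay system $\dot x(t)=A_0x(t)+A_1x(t-\tau)$ is exponentially stable. Let $W\in\mathbb{R}^{n\times n}$ be any symmetric matrix, and let $U\in\mathcal{C}^0([-\tau,\tau],\mathbb{C}^{n\times n})$ be the solution of the delay Lyapunov equations associated with $A_0,A_1,\tau,W$. Then, for any real $c\neq 0$, $X=U(\tau/2)$ is the unique solution $X\in\mathbb{R}^{n\times n}$ of the linear system $$L_c(X)=-W .$$
   Context: Exponential stability: the system $\dot x(t)=A_0x(t)+A_1x(t-\tau)$ is exponentially stable if there is $\beta>0$ such that for every solution $x$ (with arbitrary continuous initial function on $[-\tau,0]$) there is $\alpha>0$ with $\|x(t)\|\le \alpha e^{-\beta t}$ for all $t\ge 0$. Delay Lyapunov equations: find $U\in\mathcal{C}^0([-\tau,\tau],\mathbb{C}^{n\times n})$ such that $$U'(t)=U(t)A_0+U(t-\tau)A_1\quad (0<t\le\tau,\ \text{one-sided derivative at } t=\tau),$$ $$U(-t)=U(t)^T\quad (t\in[-\tau,\tau]),$$ $$-W=U(0)A_0+A_0^TU(0)+U(\tau)^TA_1+A_1^TU(\tau).$$ It is a known fact that, when the system is exponentially stable, these equations have a unique solution $U$ for each symmetric $W$. Operator $L_c$: for $c\in\mathbb{R}$ and $X\in\mathbb{R}^{n\times n}$, let $Z_1,Z_2:[0,\tau/2]\to\mathbb{R}^{n\times n}$ be the unique solutions of the initial value problem $$Z_1'(t)=Z_1(t)A_0+Z_2(t)^TA_1,\qquad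 Z_2'(t)=-Z_1(t)^TA_1-Z_2(t)A_0,\qquad Z_1(0)=Z_2(0)=X,$$ and define the linear map $L_c:\mathbb{R}^{n\times n}\to\mathbb{R}^{n\times n}$ by $$L_c(X):=Z_2(\tau/2)^T(A_0-cI)+(A_0^T+cI)Z_2(\tau/2)+Z_1(\tau/2)^TA_1+A_1^TZ_1(\tau/2).$$ *)

(* Defs.v *)
From HB Require Import structures.
From mathcomp Require Import all_boot all_order all_algebra.
From mathcomp Require Import all_classical all_reals all_analysis.
From mathcomp.real_closed Require Import complex.

Set Implicit Arguments.
Unset Strict Implicit.
Unset Printing Implicit Defensive.

Import Order.TTheory GRing.Theory Num.Theory numFieldNormedType.Exports.
Local Open Scope classical_set_scope.
Local Open Scope ring_scope.

(* R[i] is packaged as a numFieldType because MathComp-Analysis puts the norm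
   topology on a field through this structure only. *)
Definition Cplx (R : realType) : numFieldType := R[i].

Definition mxC (R : realType) (m n : nat) (A : 'M[R]_(m, n)) :
    'M[Cplx R]_(m, n) :=
  map_mx (real_complex R) A.

(* F has derivative L at t relative to the domain D. It is one-sided when t is
   an endpoint of the interval D, two-sided in the interior. The embedding iota
   lets the real variable act on K, for K = R and K = R[i]. *)
Definition has_deriv_within (R : realType) (K : numFieldType)
    (iota : {rmorphism R -> K}) (m n : nat) (D : set R)
    (F : R -> 'M[K]_(m, n)) (t : R) (L : 'M[K]_(m, n)) : Prop :=
  (fun s : R => iota (s - t)^-1 *: (F s - F t)) @ within D t^' --> L.

Definition has_derivR (R : realType) (m n : nat) (D : set R)
    (F : R -> 'M[R]_(m, n)) (t : R) (L : 'M[R]_(m, n)) : Prop :=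
  has_deriv_within (@idfun R) D F t L.

Definition has_derivC (R : realType) (m n : nat) (D : set R)
    (F : R -> 'M[Cplx R]_(m, n)) (t : R) (L : 'M[Cplx R]_(m, n)) : Prop :=
  has_deriv_within (real_complex R) D F t L.

(* Only the values of x on [-tau, +oo[ matter; the initial function is the
   restriction of x to [-tau, 0], an arbitrary continuous function. *)
Definition is_delay_solution (R : realType) (n : nat) (A0 A1 : 'M[R]_n)
    (tau : R) (x : R -> 'cV[R]_n) : Prop :=
  {within `[- tau, +oo[, continuous x} /\
  forall t : R, 0 <= t ->
    has_derivR `[0, +oo[ x t (A0 *m x t + A1 *m x (t - tau)).

Definition exponentially_stable (R : realType) (n : nat) (A0 A1 : 'M[R]_n)
    (tau : R) : Prop :=
  exists2 beta : R, 0 < beta &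
    forall x : R -> 'cV[R]_n, is_delay_solution A0 A1 tau x ->
      exists2 alpha : R, 0 < alpha &
        forall t : R, 0 <= t -> `|x t| <= alpha * expR (- (beta * t)).

(* Only the values of U on [-tau, tau] matter. The transpose is the plain one,
   without conjugation. *)
Definition is_delay_lyapunov_solution (R : realType) (n : nat)
    (A0 A1 : 'M[R]_n) (tau : R) (W : 'M[R]_n) (U : R -> 'M[Cplx R]_n) : Prop :=
  [/\ {within `[- tau, tau], continuous U},
      forall t : R, 0 < t <= tau ->
        has_derivC `[- tau, tau] U t
          (U t *m mxC A0 + U (t - tau) *m mxC A1),
      forall t : R, - tau <= t <= tau -> U (- t) = (U t)^T &
      - mxC W = U 0 *m mxC A0 + (mxC A0)^T *m U 0
              + (U tau)^T *m mxC A1 + (mxC A1)^T *m U tau].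

Definition is_Z_solution (R : realType) (n : nat) (A0 A1 : 'M[R]_n)
    (tau : R) (X : 'M[R]_n) (Z : (R -> 'M[R]_n) * (R -> 'M[R]_n)) : Prop :=
  [/\ forall t : R, 0 <= t <= tau / 2 ->
        has_derivR `[0, tau / 2] Z.1 t (Z.1 t *m A0 + (Z.2 t)^T *m A1),
      forall t : R, 0 <= t <= tau / 2 ->
        has_derivR `[0, tau / 2] Z.2 t (- ((Z.1 t)^T *m A1) - Z.2 t *m A0),
      Z.1 0 = X & Z.2 0 = X].

(* The initial value problem is linear with constant coefficients, so a solution
   exists and is unique on [0, tau / 2]: the default value is never used, and
   the values of Z_sol on [0, tau / 2] do not depend on the choice. *)
Definition Z_sol (R : realType) (n : nat) (A0 A1 : 'M[R]_n) (tau : R)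
    (X : 'M[R]_n) : (R -> 'M[R]_n) * (R -> 'M[R]_n) :=
  xget (fun=> 0, fun=> 0) [set Z | is_Z_solution A0 A1 tau X Z].

Definition Lc (R : realType) (n : nat) (A0 A1 : 'M[R]_n) (tau c : R)
    (X : 'M[R]_n) : 'M[R]_n :=
  let Z1 := (Z_sol A0 A1 tau X).1 (tau / 2) in
  let Z2 := (Z_sol A0 A1 tau X).2 (tau / 2) in
  Z2^T *m (A0 - c%:M) + (A0^T + c%:M) *m Z2 + Z1^T *m A1 + A1^T *m Z1.

(* Main.v *)
(** A non-zero solution of the homogeneous problem would generate a space of
    reflected trajectories invariant under [d/dt].  Put [P t = U t] and
    [Q t = U (t - tau)]: then [(P, Q)' = (P A0 + Q A1, - A0^T Q - A1^T P)], a
    linear ODE with constant coefficients, and [Z1 t = U (tau/2 + t)],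
    [Z2 t = U (tau/2 - t)] are read off its forward and backward flows from the
    single state [(X, X^T)] with [X = U (tau/2)].  The two gluing conditions at
    time [tau/2] (continuity and differentiability of [U] at [0]) cut out a
    subspace stable under the ODE matrix.  If it is non-zero, it contains a
    complex eigenvector with eigenvalue [s], for which [P = e^(s tau) Q]; then
    [P] is a left null vector of [s - A0 - e^(-s tau) A1] and [Q^T] one of
    [- s - A0 - e^(s tau) A1].  So both [s] and [- s] are characteristic roots,
    whereas exponential stability puts every characteristic root in the open
    left half-plane.

    Both parts of the theorem follow: with [W = 0] this kills the imaginary
    part of [U], and if [Lc Y = - W] then the antisymmetric part of the equation,
    [c (Z2 - Z2^T) = 0], together with its symmetric part says that the
    difference of the states for [Y] and [X] satisfies the gluing conditions. *)

Require Import Defs.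
From HB Require Import structures.
From mathcomp Require Import all_boot all_order all_algebra.
From mathcomp Require Import all_classical all_reals all_analysis.
From mathcomp.real_closed Require Import complex.
From mathcomp Require Import ring lra.

Set Implicit Arguments.
Unset Strict Implicit.
Unset Printing Implicit Defensive.

Import Order.TTheory GRing.Theory Num.Theory numFieldNormedType.Exports.
Local Open Scope classical_set_scope.
Local Open Scope ring_scope.

(** * Matrix exponentials from entire power series *)

Section ExponentialPowerSeries.
Variable R : realType.
Implicit Types (a : nat -> R) (x : R).

(* [exp_series a] is the exponential generating function of [a]; the geometric
   bound makes it entire, and differentiation shifts the coefficients. *)
Definition exp_bounded a : Prop :=
  exists b C : R, [/\ 0 <= b, 0 <= C & forall k, `|a k| <= b * C ^+ k].

Definition exp_series a x : R := limn (pseries (fun k => a k / k`!%:R) x).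

Lemma exp_boundedS a : exp_bounded a -> exp_bounded (fun k => a k.+1).
Proof.
move=> [b [C [b0 C0 aC]]]; exists (b * C), C.
split => //; first exact: mulr_ge0.
by move=> k; rewrite -mulrA -exprS.
Qed.

Lemma cvg_exp_series a x :
  exp_bounded a -> cvgn (pseries (fun k => a k / k`!%:R) x).
Proof.
move=> [b [C [b0 C0 aC]]]; apply: normed_cvg.
apply: (@series_le_cvg _ _ (fun k => b * exp_coeff (C * `|x|) k)) => [k|k|k|].
- exact: normr_ge0.
- rewrite /exp_coeff /= mulr_ge0// divr_ge0// exprn_ge0// mulr_ge0//.
- rewrite /exp_coeff /= normrM normrM normrX normfV normr_nat exprMn.
  rewrite mulrAC !mulrA ler_pM2r ?invr_gt0 ?ltr0n ?fact_gt0//.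
  by rewrite ler_wpM2r// exprn_ge0.
- exact/is_cvg_seriesZ/is_cvg_series_exp_coeff.
Qed.

Lemma is_derive_exp_series a x : exp_bounded a ->
  is_derive x 1 (exp_series a) (exp_series (fun k => a k.+1) x).
Proof.
have diffsE c :
    pseries_diffs (fun k => c k / k`!%:R) = (fun k => c k.+1 / k`!%:R) :> R^nat.
  apply/funext => k; rewrite /pseries_diffs factS natrM invfM.
  by rewrite [_^-1 * _]mulrC mulrCA [k.+1%:R * _]mulrCA mulfV ?mulr1// pnatr_eq0.
move=> ba; rewrite /exp_series -diffsE.
(* Termwise differentiation at [x] asks for a point of larger modulus where the series and its first
   two derived series converge; [|x| + 1] serves. *)
apply: (@pseries_snd_diffs _ _ (`|x| + 1)); rewrite ?diffsE.
- exact: cvg_exp_series.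
- exact/cvg_exp_series/exp_boundedS.
- apply: (@cvg_exp_series (fun k => a k.+2)).
  exact/(@exp_boundedS (fun k => a k.+1))/exp_boundedS.
- by rewrite [ltRHS]ger0_norm ?ltrDl// addr_ge0.
Qed.

Lemma exp_series0 a : exp_series a 0 = a 0%N.
Proof.
apply: cvg_lim => //; apply: cvg_near_cst; exists 1%N => // N N0 /=.
rewrite /pseries /series /= -(prednK N0) big_nat_recl// expr0 mulr1 divr1.
by rewrite big1 ?addr0// => i _; rewrite expr0n mulr0.
Qed.

Lemma exp_series_sum m (c : 'I_m -> R) (a : 'I_m -> nat -> R) x :
  (forall l, exp_bounded (a l)) ->
  \sum_l c l * exp_series (a l) x = exp_series (fun k => \sum_l c l * a l k) x.
Proof.
move=> ba; apply/esym/cvg_lim => //.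
rewrite (_ : pseries _ x =
    fun N => \sum_l c l * pseries (fun k => a l k / k`!%:R) x N); last first.
  apply/funext => N; rewrite /pseries /series /=.
  under eq_bigr do rewrite mulr_suml mulr_suml.
  rewrite exchange_big; apply: eq_bigr => l _; rewrite mulr_sumr.
  by apply: eq_bigr => k _; rewrite !mulrA.
apply: cvg_big => // [|l _]; first exact: add_continuous.
by apply: cvgMr; exact: cvg_exp_series.
Qed.

End ExponentialPowerSeries.

Section MatrixExponential.
Variables (R : realType) (m : nat).
Implicit Types (M : 'M[R]_m) (t : R).

(** This is [e^(tM)], taken entry by entry so that convergence and differentiation are those of
    scalar series. *)
Definition expm M t : 'M[R]_m :=
  \matrix_(i, j) exp_series (fun k => (M ^+ k) i j) t.

Lemma exp_bounded_mxX M i j : exp_bounded (fun k => (M ^+ k) i j).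
Proof.
(* The sum of all moduli dominates every column sum, so the bound [C ^+ k] passes through the
   induction on [k]. *)
pose C := \sum_i \sum_j `|M i j|.
have C0 : 0 <= C by apply: sumr_ge0 => ? _; apply: sumr_ge0.
exists 1, C; split => // k; rewrite mul1r.
elim: k => [|k IH] in i j *.
  by rewrite !expr0 mxE; case: (i == j); rewrite ?normr1 ?normr0.
rewrite exprSr mxE (le_trans (ler_norm_sum _ _ _))//.
rewrite exprSr mulr_sumr ler_sum// => l _; rewrite normrM ler_pM//.
by rewrite (bigD1 j)//= lerDl sumr_ge0.
Qed.

Lemma expm0 M : expm M 0 = 1%:M.
Proof. by apply/matrixP => i j; rewrite mxE exp_series0 expr0. Qed.

(** A product with [M] shifts the coefficients by one, and so does differentiation: hence [expm M]
    solves the linear equation. *)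
Lemma mulmx_expm M t :
  M *m expm M t = \matrix_(i, j) exp_series (fun k => (M ^+ k.+1) i j) t.
Proof.
apply/matrixP => i j; rewrite !mxE; under eq_bigr do rewrite mxE.
rewrite exp_series_sum => [|l]; last exact: exp_bounded_mxX.
by congr (exp_series _ t); apply/funext => k; rewrite exprS mxE.
Qed.

Lemma expm_comm M t : expm M t *m M = M *m expm M t.
Proof.
rewrite mulmx_expm; apply/matrixP => i j; rewrite !mxE.
under eq_bigr do rewrite mxE mulrC.
rewrite exp_series_sum => [|l]; last exact: exp_bounded_mxX.
congr (exp_series _ t); apply/funext => k.
by rewrite exprSr mxE; apply: eq_bigr => l _; rewrite mulrC.
Qed.

Lemma is_derive_expm M t i j :
  is_derive t 1 (fun s => expm M s i j) ((M *m expm M t) i j).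
Proof.
rewrite mulmx_expm mxE; under eq_fun do rewrite mxE.
exact/is_derive_exp_series/exp_bounded_mxX.
Qed.

End MatrixExponential.

(** * Entrywise calculus on [[0, T]] and uniqueness for linear differential equations *)

Section MatrixDerivatives.
Variables (R : realType) (T : R).

(** Continuity up to the endpoints and a two-sided derivative inside are what the mean value theorem
    consumes; no one-sided derivative has to be handled. *)
Definition mx_deriv_on p q (F F' : R -> 'M[R]_(p, q)) : Prop :=
  forall i j, {within `[0, T], continuous (fun t => F t i j)} /\
    forall t, t \in `]0, T[ -> is_derive t 1 (fun s => F s i j) (F' t i j).

Lemma eq_mx_deriv_on p q (F F' G' : R -> 'M[R]_(p, q)) :
  (forall t, t \in `]0, T[ -> F' t = G' t) ->
  mx_deriv_on F F' -> mx_deriv_on F G'.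
Proof.
move=> FG dF i j; have [cF dFij] := dF i j; split=> // t tT.
by rewrite -FG//; exact: dFij.
Qed.

Lemma mx_deriv_on_everywhere p q (F F' : R -> 'M[R]_(p, q)) :
  (forall (t : R) i j, is_derive t 1 (fun s => F s i j) (F' t i j)) ->
  mx_deriv_on F F'.
Proof.
move=> dF i j; split=> [|t _]; last exact: dF.
apply: derivable_within_continuous => t _; have := dF t i j.
by move=> h; apply: ex_derive.
Qed.

Lemma mx_deriv_onM p q r (F F' : R -> 'M[R]_(p, q)) (G G' : R -> 'M[R]_(q, r)) :
  mx_deriv_on F F' -> mx_deriv_on G G' ->
  mx_deriv_on (fun t => F t *m G t) (fun t => F' t *m G t + F t *m G' t).
Proof.
move=> dF dG i j.
rewrite (_ : (fun t => (F t *m G t) i j) =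
    \sum_k (fun t => F t i k * G t k j)); last first.
  by apply/funext => t; rewrite mxE fct_sumE.
split=> [t|t tT].
  rewrite fct_sumE; apply: cvg_big => // [|k _]; first exact: add_continuous.
  by apply: cvgM; [exact: (dF i k).1|exact: (dG k j).1].
have dFk k := (dF i k).2 t tT; have dGk k := (dG k j).2 t tT.
have dFG k : is_derive t 1 (fun s => F s i k * G s k j)
    (F' t i k * G t k j + F t i k * G' t k j).
  apply: is_derive_eq; rewrite addrC; congr (_ + _).
  by rewrite mulrC.
apply: is_derive_eq; rewrite !mxE -big_split.
by apply: eq_bigr.
Qed.

Lemma mx_deriv_on_tr p q (F F' : R -> 'M[R]_(p, q)) :
  mx_deriv_on F F' -> mx_deriv_on (fun t => (F t)^T) (fun t => (F' t)^T).
Proof.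
move=> dF i j; rewrite (_ : (fun t => _ i j) = fun t => F t j i); last first.
  by apply/funext => t; rewrite mxE.
by have [cF dFji] := dF j i; split=> // t /dFji; rewrite mxE.
Qed.

Lemma mx_deriv_on_col_mx p1 p2 q (F F' : R -> 'M[R]_(p1, q))
    (G G' : R -> 'M[R]_(p2, q)) :
  mx_deriv_on F F' -> mx_deriv_on G G' ->
  mx_deriv_on (fun t => col_mx (F t) (G t)) (fun t => col_mx (F' t) (G' t)).
Proof.
move=> dF dG i j; rewrite -(splitK i); case: (fintype.split i) => k /=.
  rewrite (_ : (fun t => _ j) = fun t => F t k j); last first.
    by apply/funext => t; rewrite col_mxEu.
  by have [cF dFkj] := dF k j; split=> // t /dFkj; rewrite col_mxEu.
rewrite (_ : (fun t => _ j) = fun t => G t k j); last first.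
  by apply/funext => t; rewrite col_mxEd.
by have [cG dGkj] := dG k j; split=> // t /dGkj; rewrite col_mxEd.
Qed.

Lemma mx_deriv_on_mxvec p q (F F' : R -> 'M[R]_(p, q)) :
  mx_deriv_on F F' -> mx_deriv_on (fun t => mxvec (F t)) (fun t => mxvec (F' t)).
Proof.
move=> dF i k; rewrite ord1; case/mxvec_indexP: k => k l.
rewrite (_ : (fun t => _ 0 _) = fun t => F t k l); last first.
  by apply/funext => t; rewrite mxvecE.
by have [cF dFkl] := dF k l; split=> // t /dFkl; rewrite mxvecE.
Qed.

Lemma mx_deriv_on0 p q (F F' : R -> 'M[R]_(p, q)) : 0 <= T ->
  mx_deriv_on F F' -> (forall t, t \in `]0, T[ -> F' t = 0) -> F T = F 0.
Proof.
move=> T0 dF F0; apply/matrixP => i j; have [cF dFij] := dF i j.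
have dF0 t : t \in `]0, T[ -> is_derive t 1 (fun s => F s i j) 0.
  by move=> tT; have := dFij t tT; rewrite F0// mxE.
have [c _] := @MVT_segment _ _ (fun=> 0) _ _ T0 dF0 cF.
by rewrite mul0r => /eqP; rewrite subr_eq0 => /eqP.
Qed.

End MatrixDerivatives.

Section LinearODE.
Variables (R : realType) (m : nat).
Implicit Types (M : 'M[R]_m) (T : R).

Lemma mx_deriv_on_expm M T :
  mx_deriv_on T (fun t => expm M t) (fun t => M *m expm M t).
Proof. by apply: mx_deriv_on_everywhere => t i j; exact: is_derive_expm. Qed.

(* [w(t) expm (- M) t] is constant. *)
Lemma mulmx_expmN M T p (w : R -> 'M[R]_(p, m)) : 0 <= T ->
  mx_deriv_on T w (fun t => w t *m M) -> w T *m expm (- M) T = w 0.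
Proof.
move=> T0 dw; have := mx_deriv_onM dw (mx_deriv_on_expm (- M) T).
move=> /(mx_deriv_on0 T0) /= ->; first by rewrite expm0 mulmx1.
by move=> t _; rewrite mulmxA mulmxN mulNmx subrr.
Qed.

(** Since [expm M] commutes with [M], it is itself a solution to which [mulmx_expmN] applies; this
    gives the product in the other order, and a one-sided inverse of a square matrix is
    two-sided. *)
Lemma expmNK M T : 0 <= T -> expm (- M) T *m expm M T = 1%:M.
Proof.
move=> T0; apply: mulmx1C; rewrite (@mulmx_expmN M T _ (expm M)) ?expm0//.
apply: eq_mx_deriv_on (mx_deriv_on_expm M T) => t _.
exact/esym/expm_comm.
Qed.

Lemma linear_ode_unique M T p (w : R -> 'M[R]_(p, m)) : 0 <= T ->
  mx_deriv_on T w (fun t => w t *m M) -> w T = w 0 *m expm M T.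
Proof.
move=> T0 dw.
by rewrite -(mulmx_expmN T0 dw) -mulmxA expmNK// mulmx1.
Qed.

End LinearODE.

(** * Complex exponentials and the real flow on complex eigenvectors *)

Section ComplexExponential.
Variable R : realType.
Implicit Types (s z : R[i]) (t : R).

Definition cexp s : R[i] :=
  Complex (expR (complex.Re s) * cos (complex.Im s))
          (expR (complex.Re s) * sin (complex.Im s)).

Lemma cexp0 : cexp 0 = 1.
Proof. by rewrite /cexp /= expR0 cos0 sin0 mul1r mulr0. Qed.

Lemma cexpD s z : cexp (s + z) = cexp s * cexp z.
Proof.
case: s => a b; case: z => c d; apply/eqP; rewrite eq_complex /=.
by rewrite expRD cosD sinD; apply/andP; split; apply/eqP; ring.
Qed.

Lemma cexpNK s : cexp (- s) * cexp s = 1.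
Proof. by rewrite -cexpD addNr cexp0. Qed.

Lemma is_derive_Re_cexp s z t :
  is_derive t 1 (fun u => complex.Re (cexp (u%:C%C * s) * z))
    (complex.Re (s * cexp (t%:C%C * s) * z)).
Proof.
case: s => a b; case: z => x y.
rewrite (_ : (fun u => _) = fun u =>
    expR (a * u) * cos (b * u) * x - expR (a * u) * sin (b * u) * y); last first.
  by apply/funext => u; rewrite /= !mul0r subr0 addr0 ![u * _]mulrC.
have lin c : is_derive t 1 (fun u => c * u) c.
  by apply: is_derive_eq; rewrite /GRing.scale /= mulr1.
have dE : is_derive t 1 (fun u => expR (a * u)) (expR (a * t) * a).
  exact: (@is_derive1_comp _ expR).
have dC : is_derive t 1 (fun u => cos (b * u)) (- sin (b * t) * b).
  exact: (@is_derive1_comp _ cos).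
have dS : is_derive t 1 (fun u => sin (b * u)) (cos (b * t) * b).
  exact: (@is_derive1_comp _ sin).
apply: is_derive_eq; rewrite /GRing.scale /= !mul0r subr0 addr0 ![t * _]mulrC.
ring.
Qed.

(** It transfers facts about real parts to imaginary parts. *)
Lemma Im_Re z : complex.Im z = complex.Re (z * - 'i%C).
Proof. by case: z => x y /=; ring. Qed.

Lemma is_derive_Im_cexp s z t :
  is_derive t 1 (fun u => complex.Im (cexp (u%:C%C * s) * z))
    (complex.Im (s * cexp (t%:C%C * s) * z)).
Proof.
rewrite Im_Re -mulrA (_ : (fun u => _) =
    fun u => complex.Re (cexp (u%:C%C * s) * (z * - 'i%C))).
  exact: is_derive_Re_cexp.
by apply/funext => u; rewrite Im_Re mulrA.
Qed.

End ComplexExponential.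

Section ComplexMatrices.
Variables (R : realType).
Local Notation toC := (map_mx (real_complex R)).

Definition Remx p q (A : 'M[R[i]]_(p, q)) : 'M[R]_(p, q) :=
  map_mx (@complex.Re R) A.
Definition Immx p q (A : 'M[R[i]]_(p, q)) : 'M[R]_(p, q) :=
  map_mx (@complex.Im R) A.

Lemma Re_sum p (f : 'I_p -> R[i]) :
  complex.Re (\sum_k f k) = \sum_k complex.Re (f k).
Proof. exact: (raddf_sum (@complex.Re R : Rcomplex R -> R)). Qed.

Lemma Im_sum p (f : 'I_p -> R[i]) :
  complex.Im (\sum_k f k) = \sum_k complex.Im (f k).
Proof. exact: (raddf_sum (@complex.Im R : Rcomplex R -> R)). Qed.

Lemma RemxMr p q r (A : 'M[R[i]]_(p, q)) (B : 'M[R]_(q, r)) :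
  Remx (A *m toC B) = Remx A *m B.
Proof.
apply/matrixP => i j; rewrite !mxE Re_sum; apply: eq_bigr => k _.
by rewrite !mxE; case: (A i k) => x y /=; rewrite mulr0 subr0.
Qed.

Lemma ImmxMr p q r (A : 'M[R[i]]_(p, q)) (B : 'M[R]_(q, r)) :
  Immx (A *m toC B) = Immx A *m B.
Proof.
apply/matrixP => i j; rewrite !mxE Im_sum; apply: eq_bigr => k _.
by rewrite !mxE; case: (A i k) => x y /=; rewrite mulr0 add0r.
Qed.

Lemma RemxMl p q r (A : 'M[R[i]]_(q, r)) (B : 'M[R]_(p, q)) :
  Remx (toC B *m A) = B *m Remx A.
Proof.
apply/matrixP => i j; rewrite !mxE Re_sum; apply: eq_bigr => k _.
by rewrite !mxE; case: (A k j) => x y /=; rewrite mul0r subr0.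
Qed.

Lemma ReIm_mx_inj p q (A B : 'M[R[i]]_(p, q)) :
  Remx A = Remx B -> Immx A = Immx B -> A = B.
Proof.
move=> ReAB ImAB; apply/matrixP => i j; apply/eqP; rewrite eq_complex.
move/matrixP/(_ i j): ReAB; rewrite !mxE => ->.
by move/matrixP/(_ i j): ImAB; rewrite !mxE => ->; rewrite !eqxx.
Qed.

(** The curve [cexp (t s) *: e] solves [g' = g M]. As [M] is real, its real and imaginary parts
    solve the same equation, and real uniqueness applies to each. *)
Lemma expm_eigenvector m (M : 'M[R]_m) T (e : 'rV[R[i]]_m) (s : R[i]) : 0 <= T ->
  e *m toC M = s *: e -> e *m toC (expm M T) = cexp (T%:C%C * s) *: e.
Proof.
move=> T0 eM; pose g t := cexp (t%:C%C * s) *: e.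
have g0 : g 0 = e by rewrite /g mul0r cexp0 scale1r.
have gM t : g t *m toC M = s *: g t.
  by rewrite /g -scalemxAl eM !scalerA mulrC.
have dRe : mx_deriv_on T (fun t => Remx (g t)) (fun t => Remx (g t) *m M).
  apply: mx_deriv_on_everywhere => t i j; rewrite -RemxMr gM.
  under eq_fun do rewrite !mxE.
  by rewrite !mxE mulrA; exact: is_derive_Re_cexp.
have dIm : mx_deriv_on T (fun t => Immx (g t)) (fun t => Immx (g t) *m M).
  apply: mx_deriv_on_everywhere => t i j; rewrite -ImmxMr gM.
  under eq_fun do rewrite !mxE.
  by rewrite !mxE mulrA; exact: is_derive_Im_cexp.
have := linear_ode_unique T0 dRe; have := linear_ode_unique T0 dIm.
rewrite /= g0 => ImT ReT; apply/ReIm_mx_inj.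
  by rewrite RemxMr -ReT.
by rewrite ImmxMr -ImT.
Qed.

End ComplexMatrices.

(** * Derivatives relative to a set, and their comparison with interior derivatives *)

Section DerivativesWithin.
Variable R : realType.

Lemma cvg_mxP (K : numFieldType) p q (S : Type) (G : set_system S)
    (FG : Filter G) (f : S -> 'M[K]_(p, q)) (L : 'M[K]_(p, q)) :
  f @ G --> L <-> forall i j, (fun s => f s i j) @ G --> L i j.
Proof.
split=> [fL i j|fL A [P PL PA]].
  exact: (cvg_comp _ _ fL (@coord_continuous _ _ _ i j L)).
apply: filterS (PA) _.
apply: (@filter_forall _ _ (fun i s => forall j, P i j (f s i j))) => i.
apply: (@filter_forall _ _ (fun j s => P i j (f s i j))) => j.
exact: fL (PL i j).
Qed.

Definition deriv_within (D : set R) (f : R -> R) (t l : R) : Prop :=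
  (fun s => (s - t)^-1 * (f s - f t)) @ within D t^' --> l.

Lemma has_derivR_coordP p q (D : set R) (F : R -> 'M[R]_(p, q)) t L :
  has_derivR D F t L <->
  forall i j, deriv_within D (fun s => F s i j) t (L i j).
Proof.
split=> [/cvg_mxP dF i j|dF]; last apply/cvg_mxP => i j.
  by apply: cvg_trans (dF i j); apply: near_eq_cvg; near=> s; rewrite !mxE.
by apply: cvg_trans (dF i j); apply: near_eq_cvg; near=> s; rewrite !mxE.
Unshelve. all: by end_near. Qed.

Lemma is_derive_deriv_within (D : set R) f (t l : R) :
  is_derive t 1 f l -> deriv_within D f t l.
Proof.
case=> df <-; apply: cvg_within_filter; apply/cvgrPdist_lt => e e0.
have /cvgrPdist_lt/(_ _ e0) [d d0 de] := df.
exists d => //= s ds st; have := de (s - t).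
rewrite /= sub0r normrN distrC => /(_ ds); rewrite subr_eq0 => /(_ st).
by rewrite [_%:A]mulr1 subrK.
Qed.

Lemma deriv_within_is_derive (D : set R) f (t l : R) :
  nbhs t D -> deriv_within D f t l -> is_derive t 1 f l.
Proof.
move=> [r r0 rD] /cvgrPdist_lt dl.
have {dl} : (fun h : R => h^-1 *: (f (h *: 1 + t) - f t)) @ 0^' --> l.
  apply/cvgrPdist_lt => e e0; have [d d0 de] := dl e e0.
  exists (Num.min d r) => [|h] /=; first by rewrite lt_min d0.
  rewrite sub0r normrN lt_min => /andP[hd hr] h0.
  have := de (h + t); rewrite /= opprD addrCA subrr addr0 normrN => /(_ hd).
  rewrite -subr_eq0 addrK [_%:A]mulr1; apply=> //.
  by apply: rD; rewrite /ball /= opprD addrCA subrr addr0 normrN.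
move=> dl; apply: DeriveDef; first by apply/cvg_ex; exists l.
exact: cvg_lim.
Qed.

Lemma deriv_within_continuous (D : set R) f (t l : R) :
  deriv_within D f t l -> f @ within D (nbhs t) --> f t.
Proof.
move=> /cvgrPdist_lt/(_ _ ltr01) [d d0 dl]; apply/cvgrPdist_lt => e e0.
(* Within distance [d] of [t] the difference quotient is at most [|l| + 1] in modulus, whence the
   radius [e / (|l| + 1)]. *)
have l1 : 0 < `|l| + 1 by rewrite ltr_wpDl.
exists (Num.min d (e / (`|l| + 1))) => [|s] /=.
  by rewrite lt_min d0 divr_gt0.
rewrite lt_min ltr_pdivlMr// => /andP[sd se] Ds.
have [->|st] := eqVneq s t; first by rewrite subrr normr0.
have := dl s sd st Ds; rewrite distrC => qs; rewrite distrC.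
have -> : f s - f t = (s - t) * ((s - t)^-1 * (f s - f t)).
  by rewrite mulVKf// subr_eq0.
rewrite normrM distrC (le_lt_trans _ se)// ler_wpM2l//.
by rewrite -lerBlDl (le_trans (lerB_dist _ _))// ltW.
Qed.

Lemma has_derivR_mx_deriv_on p q T (F F' : R -> 'M[R]_(p, q)) :
  (forall t, 0 <= t <= T -> has_derivR `[0, T] F t (F' t)) -> mx_deriv_on T F F'.
Proof.
move=> dF i j; split=> [|t].
  apply/subspace_continuousP => t; rewrite /= in_itv/= => /dF.
  by move=> /has_derivR_coordP/(_ i j)/deriv_within_continuous.
rewrite in_itv/= => /andP[t0 tT].
have /dF/has_derivR_coordP/(_ i j) : 0 <= t <= T by rewrite !ltW.
apply: deriv_within_is_derive.
have : \forall s \near t, s \in `]0, T[.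
  by apply: near_in_itvoo; rewrite in_itv/= t0 tT.
by apply: filterS => s /=; rewrite !in_itv/= => /andP[s0 sT]; rewrite !ltW.
Qed.

End DerivativesWithin.

(** * Exponential stability and characteristic roots *)

Section CharacteristicRoots.
Variables (R : realType) (n : nat) (A0 A1 : 'M[R]_n) (tau : R).
Local Notation toC := (map_mx (real_complex R)).

Lemma le_coord_mx_norm p q (A : 'M[R]_(p, q)) i j : `|A i j| <= `|A|.
Proof.
rewrite [leRHS]/Num.Def.normr/= mx_normrE.
exact: (le_bigmax _ (fun ij => `|A ij.1 ij.2|) (i, j)).
Qed.

(** The stability hypothesis speaks of real solutions only. The exponential [e^(ts) v] is a complex
    solution, and its real part is a solution because [A0] and [A1] are real. *)
Lemma Re_cexp_delay_solution (s : R[i]) (v : 'cV[R[i]]_n) :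
  s *: v = toC A0 *m v + cexp (- (tau%:C%C * s)) *: (toC A1 *m v) ->
  is_delay_solution A0 A1 tau (fun t => Remx (cexp (t%:C%C * s) *: v)).
Proof.
move=> sv; pose x t := Remx (cexp (t%:C%C * s) *: v).
have dx (t : R) i j : is_derive t 1 (fun u => x u i j)
    ((A0 *m x t + A1 *m x (t - tau)) i j).
  have -> : A0 *m x t + A1 *m x (t - tau) =
      Remx (s *: (cexp (t%:C%C * s) *: v)).
    rewrite /x scalerA [s * _]mulrC -scalerA sv scalerDr !scalemxAr scalerA -cexpD.
    rewrite rmorphB /= mulrBl -!RemxMl.
    by apply/matrixP => k l; rewrite !mxE -raddfD.
  rewrite /x; under eq_fun do rewrite !mxE.
  by rewrite !mxE mulrA; exact: is_derive_Re_cexp.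
split=> [|t _]; last first.
  by apply/has_derivR_coordP => i j; exact: is_derive_deriv_within.
apply: continuous_subspaceT => t; apply/cvg_mxP => i j.
by apply/differentiable_continuous/derivable1_diffP; have := dx t i j; case.
Qed.

(** If [Re s >= 0], then [e^(ts)] has modulus at least 1 for [t >= 0], so a non-zero entry of
    [e^(ts) v] stays away from 0, against the decay of its real and imaginary parts. *)
Lemma characteristic_root_Re_lt0 (s : R[i]) (v : 'cV[R[i]]_n) :
  exponentially_stable A0 A1 tau -> v != 0 ->
  s *: v = toC A0 *m v + cexp (- (tau%:C%C * s)) *: (toC A1 *m v) ->
  complex.Re s < 0.
Proof.
move=> [b b0 stable] v0 sv; rewrite ltNge; apply/negP => s0.
have /matrix0Pn[j [k vj]] := v0; rewrite ord1 in vj.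
(* Every multiple [z *: v] satisfies the same equation; [z = 1] bounds the real part and [z = - i]
   the imaginary part. *)
have bound (z : R[i]) : exists2 a, 0 < a & forall t, 0 <= t ->
    `|complex.Re (cexp (t%:C%C * s) * (z * v j 0))| <= a * expR (- (b * t)).
  have szv : s *: (z *: v) =
      toC A0 *m (z *: v) + cexp (- (tau%:C%C * s)) *: (toC A1 *m (z *: v)).
    rewrite -!scalemxAr scalerA [s * _]mulrC -scalerA sv scalerDr !scalerA.
    by rewrite [z * _]mulrC.
  have [a a0 xa] := stable _ (Re_cexp_delay_solution szv).
  exists a => // t /xa; apply: le_trans.
  by apply: le_trans (le_coord_mx_norm _ j 0); rewrite !mxE.
have [a1 a10 re1] := bound 1; have [a2 a20 re2] := bound (- 'i%C).
pose N := complex.Re (v j 0) ^+ 2 + complex.Im (v j 0) ^+ 2.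
have N0 : 0 < N.
  rewrite lt_def addr_ge0 ?sqr_ge0// andbT paddr_eq0 ?sqr_ge0// !sqrf_eq0.
  by move: vj; rewrite eq_complex.
pose K := a1 ^+ 2 + a2 ^+ 2.
have NK t : 0 <= t -> N <= K * expR (- (b * t)) ^+ 2.
  move=> t0; have := re1 _ t0; have := re2 _ t0.
  rewrite mul1r [_ * v j 0]mulrC [_ * (v j 0 * _)]mulrA -Im_Re.
  rewrite -!(@ler_sqr _ `|_|) ?nnegrE ?mulr_ge0 ?expR_ge0 ?(ltW a10) ?(ltW a20)//.
  rewrite !real_normK ?num_real// => h2 h1.
  rewrite mulrDl -!exprMn (le_trans _ (lerD h1 h2))//.
  rewrite /cexp.
  case: (v j 0) (s) s0 @N {N0 bound h1 h2 re1 re2 sv} => x y [p q] /= p0.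
  rewrite !mul0r subr0 addr0.
  set E := expR _; set c := cos _; set d := sin _.
  have E1 : 1 <= E ^+ 2.
    by rewrite exprn_ege1// -expR0 ler_expR mulr_ge0.
  have -> : (E * c * x - E * d * y) ^+ 2 + (E * c * y + E * d * x) ^+ 2 =
      E ^+ 2 * (c ^+ 2 + d ^+ 2) * (x ^+ 2 + y ^+ 2) by ring.
  by rewrite cos2Dsin2 mulr1 ler_peMl// addr_ge0 ?sqr_ge0.
have K0 : 0 < K by rewrite addr_gt0// exprn_gt0.
(* At this time [e^(2bt) = e^(K/N) >= 1 + K/N], so [NK] would give [N + K <= K]. *)
have t0 : 0 <= K / N / (b * 2) by rewrite !divr_ge0 ?mulr_ge0// ltW.
have := NK _ t0; rewrite -expRM_natl mulrN expRN.
rewrite ler_pdivlMr ?expR_gt0//.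
have := expR_ge1Dx (2 * (b * (K / N / (b * 2)))).
have -> : 2 * (b * (K / N / (b * 2))) = K / N.
  by field; rewrite !gt_eqF.
rewrite -(ler_pM2l N0) mulrDr mulr1 mulrCA mulfV ?gt_eqF// mulr1.
by move=> h1 h2; have := le_trans h1 h2; rewrite gerDr leNgt N0.
Qed.

End CharacteristicRoots.

(** * The delay-free linear system and its gluing conditions *)

Section DelayOperator.
Variables (K : comNzRingType) (n : nat) (A0 A1 : 'M[K]_n).

(** The vector field of the pair [(P, Q)], stacked so that one matrix [delay_mx] can act on the
    vectorised state. *)
Definition delay_op (w : 'M[K]_(n + n, n)) : 'M[K]_(n + n, n) :=
  col_mx (usubmx w *m A0 + dsubmx w *m A1)
         (- (A0^T *m dsubmx w) - A1^T *m usubmx w).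

Lemma delay_op_is_linear : linear delay_op.
Proof.
move=> a w v; rewrite /delay_op !linearP /= scale_col_mx add_col_mx.
rewrite !mulmxDl -!scalemxAl; congr col_mx.
  by rewrite scalerDr addrACA.
by rewrite scalerDr addrACA.
Qed.

HB.instance Definition _ := GRing.isLinear.Build K _ _ _ delay_op delay_op_is_linear.

Definition delay_mx : 'M[K]_((n + n) * n) := lin_mx delay_op.

Lemma delay_op_col_mx P Q : delay_op (col_mx P Q) =
  col_mx (P *m A0 + Q *m A1) (- (A0^T *m Q) - A1^T *m P).
Proof. by rewrite /delay_op col_mxKu col_mxKd. Qed.

Lemma mulmx_delay e : e *m delay_mx = mxvec (delay_op (vec_mx e)).
Proof. exact: mul_rV_lin. Qed.

Lemma vec_mx_delay e : vec_mx (e *m delay_mx) = delay_op (vec_mx e).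
Proof. by rewrite mulmx_delay mxvecK. Qed.

(* The gluing condition at time [tau / 2] for the trajectory through [e], where
   [Ep] and [Em] are the flows of [delay_mx] for times [tau / 2] and
   [- tau / 2]: continuity of [U] at [0] reads [defect e = 0], and its
   differentiability reads [defect (e *m delay_mx) = 0]. *)
Definition defect (Ep Em : 'M[K]_((n + n) * n)) (e : 'rV[K]_((n + n) * n)) :
    'M[K]_n :=
  usubmx (vec_mx (e *m Em)) - dsubmx (vec_mx (e *m Ep)).

Lemma defect_is_linear Ep Em : linear (defect Ep Em).
Proof.
move=> a e f; rewrite /defect !mulmxDl -!scalemxAl !linearP /=.
by rewrite scalerDr addrACA.
Qed.

HB.instance Definition _ Ep Em :=
  GRing.isLinear.Build K _ _ _ (defect Ep Em) (defect_is_linear Ep Em).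

Lemma defect_eigenvector Ep Em e a b : e *m Ep = a *: e -> e *m Em = b *: e ->
  defect Ep Em e = b *: usubmx (vec_mx e) - a *: dsubmx (vec_mx e).
Proof. by rewrite /defect => -> ->; rewrite !linearZ. Qed.

Definition defect_mx Ep Em : 'M[K]_((n + n) * n, n * n) :=
  lin1_mx (mxvec \o defect Ep Em).

Lemma mulmx_defect Ep Em e : e *m defect_mx Ep Em = mxvec (defect Ep Em e).
Proof. by rewrite mul_rV_lin1. Qed.

(** Hence the two gluing conditions together cut out a subspace stable under [delay_mx]. *)
Lemma defect_delay2 Ep Em e :
  Ep *m delay_mx = delay_mx *m Ep -> Em *m delay_mx = delay_mx *m Em ->
  defect Ep Em e = 0 -> defect Ep Em (e *m delay_mx) = 0 ->
  defect Ep Em (e *m delay_mx *m delay_mx) = 0.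
Proof.
move=> cEp cEm.
have swap E (f : 'rV_ _) : E *m delay_mx = delay_mx *m E ->
    vec_mx (f *m delay_mx *m E) = delay_op (vec_mx (f *m E)).
  by move=> cE; rewrite -mulmxA -cE mulmxA vec_mx_delay.
rewrite /defect !swap//.
set v := vec_mx (e *m Em); set w := vec_mx (e *m Ep).
rewrite /delay_op !col_mxKu !col_mxKd.
set r := usubmx v; set u := dsubmx v; set p := usubmx w; set q := dsubmx w.
move=> /eqP; rewrite subr_eq0 => /eqP rq /eqP; rewrite subr_eq0 => /eqP ru.
rewrite rq in ru *; set k := (X in _ = X) in ru.
(* The differentiated condition gives two expressions for [k]. One is used in [k A0], the other in
   [A0^T k], and then all terms cancel. *)
have kA0 : k *m A0 = - (A0^T *m q *m A0) - A1^T *m p *m A0.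
  by rewrite mulmxDl !mulNmx.
have A0k : A0^T *m k = A0^T *m q *m A0 + A0^T *m u *m A1.
  by rewrite -ru mulmxDr !mulmxA.
rewrite -/k ru kA0 A0k mulmxDl !mulNmx mulmxDr !mulmxA.
by apply/eqP; rewrite subr_eq0 -!opprD addrACA.
Qed.

End DelayOperator.

Section MapDelayOperator.
Variables (K L : comNzRingType) (f : {rmorphism K -> L}) (n : nat).

Lemma map_delay_mx (A0 A1 : 'M[K]_n) :
  map_mx f (delay_mx A0 A1) = delay_mx (map_mx f A0) (map_mx f A1).
Proof.
apply: map_lin_mx => A.
rewrite /delay_op map_col_mx map_mxD map_mxB map_mxN !map_mxM.
by rewrite !map_trmx map_usubmx map_dsubmx.
Qed.

Lemma map_defect (Ep Em : 'M[K]_((n + n) * n)) e :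
  map_mx f (defect Ep Em e) = defect (map_mx f Ep) (map_mx f Em) (map_mx f e).
Proof.
by rewrite map_mxB map_usubmx map_dsubmx !map_vec_mx !map_mxM.
Qed.

End MapDelayOperator.

(** * Eigenvectors in stable kernels; left and right null vectors *)

Section StableSubspaces.

(** The rows of [V] form a basis of the kernel of [B], and [D] is the matrix of [M] restricted to
    it. An eigenvector of [D], which exists over a closed field, gives one of [M] through [V]. *)
Lemma eigenvector_stable_kernel (C : numClosedFieldType) m p (M : 'M[C]_m)
    (B : 'M[C]_(m, p)) (e0 : 'rV[C]_m) :
  (forall e : 'rV_m, e *m B = 0 -> e *m M *m B = 0) ->
  e0 != 0 -> e0 *m B = 0 ->
  exists (e : 'rV_m) (s : C), [/\ e != 0, e *m B = 0 & e *m M = s *: e].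
Proof.
move=> stableB e00 e0B; set V := row_base (kermx B).
have VB : V *m B = 0 by apply/eqP; rewrite -sub_kermx eq_row_base.
have /submxP [D VM] : (V *m M <= V)%MS.
  rewrite eq_row_base sub_kermx; apply/eqP/row_matrixP => i.
  have VBi : row i V *m B = 0 by rewrite -row_mul VB row0.
  by rewrite (row_mul i (V *m M)) (row_mul i V) row0; exact: stableB.
have rV : (0 < \rank (kermx B))%N.
  rewrite lt0n mxrank_eq0; apply: contraNneq e00 => kB0.
  by rewrite -submx0 -kB0 sub_kermx e0B.
have [s /eigenvalueP [f fD f0]] := eigenvalue_closed D rV.
exists (f *m V), s; split.
- by rewrite mulmx_free_eq0 ?row_base_free.
- by rewrite -mulmxA VB mulmx0.
- by rewrite -mulmxA VM mulmxA fD scalemxAl.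
Qed.

(** Either kind of null vector means a vanishing determinant, which transposition preserves. *)
Lemma right_kernel_of_left (F : fieldType) p m (P : 'M[F]_(p, m)) (D : 'M[F]_m) :
  P != 0 -> P *m D = 0 -> exists2 v : 'cV_m, v != 0 & D *m v = 0.
Proof.
move=> P0 PD; have : \det D^T == 0.
  rewrite det_tr; apply: contraNT P0 => detD.
  have uD : D \in unitmx by rewrite unitmxE unitfE.
  by rewrite -(mulmxK uD P) PD mul0mx.
case/det0P => v v0 vD; exists v^T; first by rewrite trmx_eq0.
by apply: trmx_inj; rewrite trmx_mul trmxK vD trmx0.
Qed.

End StableSubspaces.

(** * Absence of opposite characteristic roots *)

Section Nonresonance.
Variables (R : realType) (n : nat) (A0 A1 : 'M[R]_n) (tau : R).
Local Notation toC := (map_mx (real_complex R)).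
Hypotheses (tau_gt0 : 0 < tau) (stable : exponentially_stable A0 A1 tau).

Lemma left_characteristic_root_Re_lt0 (s : R[i]) (P : 'M[R[i]]_n) : P != 0 ->
  s *: P = P *m toC A0 + cexp (- (tau%:C%C * s)) *: (P *m toC A1) ->
  complex.Re s < 0.
Proof.
move=> P0 sP.
(* The characteristic matrix at [s]: [P] annihilates it from the left, and a right null vector
   yields an exponential solution. *)
pose D := s%:M - toC A0 - cexp (- (tau%:C%C * s)) *: toC A1.
have PD : P *m D = 0.
  by rewrite !mulmxBr mul_mx_scalar sP -scalemxAr addrAC addrK addrN.
have [v v0 Dv] := right_kernel_of_left P0 PD.
apply: (characteristic_root_Re_lt0 stable v0); apply/eqP.
by rewrite -subr_eq0 opprD addrA scalemxAl -mul_scalar_mx -!mulmxBl Dv.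
Qed.

Let Ep (r : R) : 'M[R]_((n + n) * n) := expm (delay_mx A0 A1) r.
Let Em (r : R) : 'M[R]_((n + n) * n) := expm (- delay_mx A0 A1) r.

Lemma defect_eq0 (e : 'rV[R]_((n + n) * n)) :
  defect (Ep (tau / 2)) (Em (tau / 2)) e = 0 ->
  defect (Ep (tau / 2)) (Em (tau / 2)) (e *m delay_mx A0 A1) = 0 -> e = 0.
Proof.
set T := tau / 2; set M := delay_mx A0 A1 => d0 d1; apply/eqP/negPn/negP => e0.
have T0 : 0 <= T by rewrite divr_ge0// ltW.
pose CM := delay_mx (toC A0) (toC A1).
have CME : toC M = CM by exact: map_delay_mx.
pose d := defect (toC (Ep T)) (toC (Em T)).
pose D := defect_mx (toC (Ep T)) (toC (Em T)).
have DP (f : 'rV_((n + n) * n)) : f *m D = 0 <-> d f = 0.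
  rewrite mulmx_defect -/d; split=> [f0|->]; last exact: linear0.
  by apply: (can_inj mxvecK); rewrite f0 linear0.
(* Both gluing conditions are encoded as the kernel of a single matrix. *)
have BP (f : 'rV_((n + n) * n)) :
    f *m row_mx D (CM *m D) = 0 <-> d f = 0 /\ d (f *m CM) = 0.
  rewrite mul_mx_row -row_mx0 mulmxA; split=> [/eq_row_mx[/DP ? /DP ?]//|].
  by move=> [/DP -> /DP ->].
have cE : toC (Ep T) *m CM = CM *m toC (Ep T).
  by rewrite -CME -!map_mxM expm_comm.
have cEm : toC (Em T) *m CM = CM *m toC (Em T).
  have := expm_comm (- M) T; rewrite mulmxN mulNmx => /oppr_inj cEm.
  by rewrite -CME -!map_mxM -/M cEm.
have dC (f : 'rV_((n + n) * n)) : d (toC f) = toC (defect (Ep T) (Em T) f).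
  by rewrite map_defect.
have stableB (f : 'rV_((n + n) * n)) :
    f *m row_mx D (CM *m D) = 0 -> f *m CM *m row_mx D (CM *m D) = 0.
  by move=> /BP[df dfM]; apply/BP; split; [|exact: (defect_delay2 cE cEm)].
have e0B : toC e *m row_mx D (CM *m D) = 0.
  by apply/BP; rewrite -CME -map_mxM !dC d0 d1 map_mx0.
have e0C : toC e != 0 by rewrite map_mx_eq0.
have [f [s [f0 /BP[df _] fM]]] := eigenvector_stable_kernel stableB e0C e0B.
have fE : f *m toC (Ep T) = cexp (T%:C%C * s) *: f.
  by apply: expm_eigenvector => //; rewrite CME.
have fEm : f *m toC (Em T) = cexp (- (T%:C%C * s)) *: f.
  rewrite -mulrN; apply: expm_eigenvector => //.
  by rewrite map_mxN CME mulmxN fM scaleNr.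
set P := usubmx (vec_mx f); set Q := dsubmx (vec_mx f).
have tauE : tau%:C%C * s = T%:C%C * s + T%:C%C * s.
  by rewrite -mulrDl -rmorphD /= -splitr.
(* On the eigenvector the continuity condition reads [e^(-Ts) P = e^(Ts) Q]; multiplying by [e^(Ts)]
   gives the full delay. *)
have PQ : P = cexp (tau%:C%C * s) *: Q.
  have /eqP : cexp (T%:C%C * s) *: d f = 0 by rewrite df scaler0.
  rewrite /d (defect_eigenvector fE fEm) scalerBr !scalerA -!cexpD subrr cexp0.
  by rewrite scale1r -tauE subr_eq0 => /eqP.
have QP : Q = cexp (- (tau%:C%C * s)) *: P.
  by rewrite PQ scalerA cexpNK scale1r.
have vecf : vec_mx f = col_mx P Q by rewrite vsubmxK.
have P0 : P != 0.
  apply: contra_neq f0 => P0; apply: (can_inj vec_mxK).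
  by rewrite vecf QP P0 scaler0 col_mx0 linear0.
have Q0 : Q != 0 by apply: contra_neq P0 => Q0; rewrite PQ Q0 scaler0.
have := vec_mx_delay (toC A0) (toC A1) f; rewrite -/CM fM linearZ /= vecf.
rewrite delay_op_col_mx scale_col_mx => /eq_col_mx[sP sQ].
have s_lt0 : complex.Re s < 0.
  by apply: (left_characteristic_root_Re_lt0 P0); rewrite sP {1}QP scalemxAl.
(* The upper block made [s] a root. The lower block, transposed, is the same equation for [Q^T] and
   [- s]. *)
have : complex.Re (- s) < 0.
  have QT0 : Q^T != 0 by rewrite trmx_eq0.
  apply: (left_characteristic_root_Re_lt0 QT0).
  rewrite scaleNr -linearZ /= sQ mulrN opprK linearB linearN /= !trmx_mul !trmxK.
  by rewrite -/P -/Q PQ linearZ -scalemxAl opprB opprK addrC.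
by case: s s_lt0 {fM fE fEm tauE PQ QP sP sQ} => x y /=; lra.
Qed.

End Nonresonance.

(** * The initial value problem for [Z1], [Z2] as a linear flow *)

Section ZFlow.
Variables (R : realType) (n : nat) (A0 A1 : 'M[R]_n) (T : R).
Hypothesis T_ge0 : 0 <= T.
Implicit Types X : 'M[R]_n.

Definition Z_ode (Z1 Z2 : R -> 'M[R]_n) : Prop :=
  mx_deriv_on T Z1 (fun t => Z1 t *m A0 + (Z2 t)^T *m A1) /\
  mx_deriv_on T Z2 (fun t => - ((Z1 t)^T *m A1) - Z2 t *m A0).

Local Notation M := (delay_mx A0 A1).

(** For [X = U (tau / 2)] this is the state [(U (tau / 2), U (- tau / 2))]. *)
Definition start X : 'rV[R]_((n + n) * n) := mxvec (col_mx X X^T).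

Lemma Z_ode_forward X Z1 Z2 : Z_ode Z1 Z2 -> Z1 0 = X -> Z2 0 = X ->
  vec_mx (start X *m expm M T) = col_mx (Z1 T) (Z2 T)^T.
Proof.
move=> [dZ1 dZ2] Z10 Z20.
have dw := mx_deriv_on_mxvec (mx_deriv_on_col_mx dZ1 (mx_deriv_on_tr dZ2)).
have := @linear_ode_unique _ _ M T _ _ T_ge0 (eq_mx_deriv_on _ dw).
rewrite /= Z10 Z20 => <-; first by rewrite mxvecK.
move=> t _; rewrite mulmx_delay mxvecK delay_op_col_mx.
congr (mxvec (col_mx _ _)).
by rewrite linearB linearN /= !trmx_mul trmxK addrC.
Qed.

(** Time reversal exchanges the roles of [Z1] and [Z2]: the pair [(Z2, Z1^T)] solves the system of
    [- M]. *)
Lemma Z_ode_backward X Z1 Z2 : Z_ode Z1 Z2 -> Z1 0 = X -> Z2 0 = X ->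
  vec_mx (start X *m expm (- M) T) = col_mx (Z2 T) (Z1 T)^T.
Proof.
move=> [dZ1 dZ2] Z10 Z20.
have dw := mx_deriv_on_mxvec (mx_deriv_on_col_mx dZ2 (mx_deriv_on_tr dZ1)).
have := @linear_ode_unique _ _ (- M) T _ _ T_ge0 (eq_mx_deriv_on _ dw).
rewrite /= Z10 Z20 => <-; first by rewrite mxvecK.
move=> t _; rewrite mulmxN mulmx_delay mxvecK delay_op_col_mx.
apply: (can_inj vec_mxK); rewrite linearN /= !mxvecK opp_col_mx; congr col_mx.
  by rewrite opprD addrC.
by rewrite opprB opprK linearD /= !trmx_mul trmxK addrC.
Qed.

Lemma Z_ode_unique X Z1 Z2 Y1 Y2 :
  Z_ode Z1 Z2 -> Z1 0 = X -> Z2 0 = X -> Z_ode Y1 Y2 -> Y1 0 = X -> Y2 0 = X ->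
  Z1 T = Y1 T /\ Z2 T = Y2 T.
Proof.
move=> dZ Z10 Z20 dY Y10 Y20.
have := Z_ode_forward dY Y10 Y20; rewrite (Z_ode_forward dZ Z10 Z20).
by move=> /eq_col_mx[-> /trmx_inj ->].
Qed.

Lemma Z_ode_defect X Z1 Z2 : Z_ode Z1 Z2 -> Z1 0 = X -> Z2 0 = X ->
  defect (expm M T) (expm (- M) T) (start X) = Z2 T - (Z2 T)^T.
Proof.
move=> dZ Z10 Z20; rewrite /defect (Z_ode_forward dZ Z10 Z20).
by rewrite (Z_ode_backward dZ Z10 Z20) col_mxKu col_mxKd.
Qed.

(** The flows commute with [M], so the endpoint states suffice. Once [Z2 T] is symmetric, the value
    is the right-hand side of the third delay Lyapunov equation. *)
Lemma Z_ode_defect_delay X Z1 Z2 : Z_ode Z1 Z2 -> Z1 0 = X -> Z2 0 = X ->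
  defect (expm M T) (expm (- M) T) (start X *m M) =
  Z2 T *m A0 + A0^T *m (Z2 T)^T + (Z1 T)^T *m A1 + A1^T *m Z1 T.
Proof.
move=> dZ Z10 Z20; have := expm_comm (- M) T.
rewrite mulmxN mulNmx => /oppr_inj comm.
rewrite /defect -!mulmxA -comm -expm_comm !mulmxA !vec_mx_delay.
rewrite (Z_ode_forward dZ Z10 Z20) (Z_ode_backward dZ Z10 Z20).
rewrite !delay_op_col_mx col_mxKu col_mxKd opprB opprK.
by rewrite [A1^T *m _ + _]addrC addrACA addrA.
Qed.

End ZFlow.

Section ZExistence.
Variables (R : realType) (n : nat) (A0 A1 : 'M[R]_n) (tau : R).

Definition Z_op (z : 'M[R]_(n + n, n)) : 'M[R]_(n + n, n) :=
  col_mx (usubmx z *m A0 + (dsubmx z)^T *m A1)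
         (- ((usubmx z)^T *m A1) - dsubmx z *m A0).

Lemma Z_op_is_linear : linear Z_op.
Proof.
move=> a w v; rewrite /Z_op !linearP /= scale_col_mx add_col_mx.
rewrite !mulmxDl -!scalemxAl !opprD !scalerDr !scalerN; congr col_mx.
  by rewrite addrACA.
by rewrite addrACA.
Qed.

HB.instance Definition _ := GRing.isLinear.Build R _ _ _ Z_op Z_op_is_linear.

(** Despite its transposes the system is linear in the stacked pair, so the exponential of the
    matrix of [Z_op] solves it. *)
Lemma Z_solution_exists (X : 'M[R]_n) :
  exists Z, is_Z_solution A0 A1 tau X Z.
Proof.
pose M := lin_mx Z_op.
pose z t := vec_mx (mxvec (col_mx X X) *m expm M t).
have dz (t : R) i j : is_derive t 1 (fun s => z s i j) (Z_op (z t) i j).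
  have -> : Z_op (z t) = vec_mx (mxvec (col_mx X X) *m (M *m expm M t)).
    by rewrite -expm_comm mulmxA mul_rV_lin mxvecK.
  set x := mxvec _; rewrite (_ : (fun s => z s i j) =
      \sum_k (fun s => x 0 k * expm M s k (mxvec_index i j))); last first.
    by apply/funext => s; rewrite mxE mxE fct_sumE.
  have dE k := is_derive_expm M t k (mxvec_index i j).
  by rewrite mxE mxE; apply: is_derive_eq; exact: eq_bigr.
have z0 : z 0 = col_mx X X by rewrite /z expm0 mulmx1 mxvecK.
exists ((fun t => usubmx (z t)), (fun t => dsubmx (z t))).
split=> [t _|t _||] /=; last 2 first.
- by rewrite z0 col_mxKu.
- by rewrite z0 col_mxKd.
- apply/has_derivR_coordP => i j; apply: is_derive_deriv_within.
  rewrite (_ : (fun s => _) = fun s => z s (lshift n i) j).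
    by have := dz t (lshift n i) j; rewrite col_mxEu.
  by apply/funext => s; rewrite mxE.
- apply/has_derivR_coordP => i j; apply: is_derive_deriv_within.
  rewrite (_ : (fun s => _) = fun s => z s (rshift n i) j).
    by have := dz t (rshift n i) j; rewrite col_mxEd.
  by apply/funext => s; rewrite mxE.
Qed.

End ZExistence.

(** * From the complex [U] to real solutions; [prj] stands for [Re] or [Im] *)

Section RealCoordinates.
Variables (R : realType) (prj : R[i] -> R).
Hypotheses (prjB : forall x y, prj (x - y) = prj x - prj y)
  (prjZ : forall (a : R) x, prj (a%:C%C * x) = a * prj x)
  (prj_le : forall x, (`|prj x|%:C)%C <= `|x|).

Lemma cvg_prj (S : Type) (G : set_system S) (FG : Filter G) (f : S -> Cplx R)
    (l : Cplx R) : f @ G --> l -> (fun s => prj (f s)) @ G --> prj l.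
Proof.
move=> /cvgrPdist_lt fl; apply/cvgrPdist_lt => e e0.
have e0C : 0 < e%:C%C :> Cplx R by rewrite (_ : 0 = 0%:C%C)// ltcR.
apply: filterS (fl _ e0C) => s fs; rewrite -prjB -ltcR.
exact: le_lt_trans (prj_le _) fs.
Qed.

Lemma has_derivC_deriv_within p q (D : set R) (F : R -> 'M[Cplx R]_(p, q))
    t L i j :
  has_derivC D F t L -> deriv_within D (fun s => prj (F s i j)) t (prj (L i j)).
Proof.
move=> /cvg_mxP /(_ i j) /cvg_prj; apply: cvg_trans; apply: near_eq_cvg.
by near=> s; rewrite !mxE prjZ prjB.
Unshelve. all: by end_near. Qed.

End RealCoordinates.

Section ReflectedSolution.
Variables (R : realType) (n : nat) (A0 A1 : 'M[R]_n) (tau : R).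
Hypothesis tau_gt0 : 0 < tau.
Local Notation T := (tau / 2).

Lemma continuous_reparam (a b c d : R) (f h : R -> R) :
  {within `[a, b], continuous f} -> continuous h ->
  (forall s, s \in `[c, d] -> h s \in `[a, b]) ->
  {within `[c, d], continuous (f \o h)}.
Proof.
move=> /subspace_continuousP cf ch hab; apply/subspace_continuousP => t tcd.
have := cf (h t) (hab _ tcd); move=> cfh P /cfh hP.
have := ch t _ hP; apply: (@filterS _ (nbhs t)) => s /= Ps scd; apply: Ps.
exact: hab.
Qed.

(** Reflection removes the delay: [(T + t) - tau = - (T - t)], so the delayed value is the transpose
    of [V (T - t)], and likewise with [t] replaced by [- t]. *)
Lemma reflected_Z_ode (V : R -> 'M[R]_n) :
  (forall i j, {within `[- tau, tau], continuous (fun t => V t i j)}) ->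
  (forall t i j, 0 < t < tau -> is_derive t 1 (fun s => V s i j)
     ((V t *m A0 + V (t - tau) *m A1) i j)) ->
  (forall t, - tau <= t <= tau -> V (- t) = (V t)^T) ->
  Z_ode A0 A1 T (fun t => V (T + t)) (fun t => V (T - t)).
Proof.
move=> cV dV Vtr.
have T2 : T + T = tau by rewrite -splitr.
have T0 : 0 < T by rewrite divr_gt0.
split=> i j; split.
- apply: (@continuous_reparam (- tau) tau 0 T
    (fun t => V t i j) (fun t => T + t)) => //.
    by move=> t; apply: cvgD; [exact: cvg_cst|exact: cvg_id].
  by move=> s; rewrite !in_itv/=; lra.
- move=> t; rewrite in_itv/= => tT.
  have := dV (T + t) i j; rewrite (_ : T + t - tau = - (T - t)); last by lra.
  rewrite Vtr; last lra.
  move=> dVt; have {}dVt := dVt ltac:(lra).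
  have dh : is_derive t 1 (fun s => T + s) 1.
    by apply: is_derive_eq; ring.
  have := @is_derive1_comp _ (fun s => V s i j) (fun s => T + s) _ _ _ dVt dh.
  by rewrite mulr1.
- apply: (@continuous_reparam (- tau) tau 0 T
    (fun t => V t i j) (fun t => T - t)) => //.
    by move=> t; apply: cvgB; [exact: cvg_cst|exact: cvg_id].
  by move=> s; rewrite !in_itv/=; lra.
- move=> t; rewrite in_itv/= => tT.
  have := dV (T - t) i j; rewrite (_ : T - t - tau = - (T + t)); last by lra.
  rewrite Vtr; last lra.
  move=> dVt; have {}dVt := dVt ltac:(lra).
  have dh : is_derive t 1 (fun s => T - s) (- 1).
    by apply: is_derive_eq; ring.
  have := @is_derive1_comp _ (fun s => V s i j) (fun s => T - s) _ _ _ dVt dh.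
  by rewrite mulrN1 !mxE opprD addrC.
Qed.

Lemma coordinate_Z_ode (W : 'M[R]_n) (U : R -> 'M[Cplx R]_n) (prj : R[i] -> R) :
  is_delay_lyapunov_solution A0 A1 tau W U ->
  (forall x y, prj (x - y) = prj x - prj y) ->
  (forall (a : R) x, prj (a%:C%C * x) = a * prj x) ->
  (forall x, (`|prj x|%:C)%C <= `|x|) ->
  (forall (A : 'M[R[i]]_n) (B : 'M[R]_n),
    map_mx prj (A *m map_mx (real_complex R) B) = map_mx prj A *m B) ->
  Z_ode A0 A1 T (fun t => map_mx prj (U (T + t) : 'M[R[i]]_n))
    (fun t => map_mx prj (U (T - t) : 'M[R[i]]_n)).
Proof.
move=> [cU dU Utr _] prjB prjZ prj_le prjM.
apply: (reflected_Z_ode (V := fun t => map_mx prj (U t : 'M[R[i]]_n))).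
- move=> i j; rewrite (_ : (fun t => _) = fun t => prj (U t i j)); last first.
    by apply/funext => s; rewrite mxE.
  apply/subspace_continuousP => t tI.
  move/subspace_continuousP : cU => /(_ t tI)/cvg_mxP/(_ i j).
  by move=> /(cvg_prj prjB prj_le).
- move=> t i j /andP[t0 tT]; rewrite -!prjM.
  have := dU t; rewrite t0 ltW// => /(_ isT).
  move=> /(has_derivC_deriv_within prjB prjZ prj_le (i := i) (j := j)).
  have prj0 : prj 0 = 0 by rewrite -[X in prj X](subrr 0) prjB subrr.
  have prjN x : prj (- x) = - prj x by rewrite -sub0r prjB prj0 sub0r.
  have prjD x y : prj (x + y) = prj x + prj y.
    by rewrite -{1}[y]opprK prjB prjN opprK.
  rewrite !mxE prjD => dUt.
  rewrite (_ : (fun s => _) = fun s => prj (U s i j)); last first.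
    by apply/funext => s; rewrite mxE.
  apply: deriv_within_is_derive dUt.
  have : \forall s \near t, s \in `]- tau, tau[.
    by apply: near_in_itvoo; rewrite in_itv/=; lra.
  by apply: filterS => s /=; rewrite !in_itv/= => /andP[s0 sT]; rewrite !ltW.
- by move=> t tI; rewrite Utr// map_trmx.
Qed.

Lemma le_normc_Re (x : R[i]) : (`|complex.Re x|%:C)%C <= `|x|.
Proof.
case: x => a b; rewrite normc_def lecR /= -sqrtr_sqr.
rewrite ler_sqrt ?addr_ge0 ?sqr_ge0//.
by rewrite lerDl sqr_ge0.
Qed.

Lemma le_normc_Im (x : R[i]) : (`|complex.Im x|%:C)%C <= `|x|.
Proof.
case: x => a b; rewrite normc_def lecR /= -sqrtr_sqr.
rewrite ler_sqrt ?addr_ge0 ?sqr_ge0//.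
by rewrite lerDr sqr_ge0.
Qed.

Lemma Re_Z_ode (W : 'M[R]_n) (U : R -> 'M[Cplx R]_n) :
  is_delay_lyapunov_solution A0 A1 tau W U ->
  Z_ode A0 A1 T (fun t => Remx (U (T + t))) (fun t => Remx (U (T - t))).
Proof.
move=> U_sol; apply: (coordinate_Z_ode U_sol).
- by case=> a b [c d].
- by move=> a [b c] /=; rewrite mul0r subr0.
- exact: le_normc_Re.
- by move=> A B; exact: RemxMr.
Qed.

Lemma Im_Z_ode (W : 'M[R]_n) (U : R -> 'M[Cplx R]_n) :
  is_delay_lyapunov_solution A0 A1 tau W U ->
  Z_ode A0 A1 T (fun t => Immx (U (T + t))) (fun t => Immx (U (T - t))).
Proof.
move=> U_sol; apply: (coordinate_Z_ode U_sol).
- by case=> a b [c d].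
- by move=> a [b c] /=; rewrite mul0r addr0.
- exact: le_normc_Im.
- by move=> A B; exact: ImmxMr.
Qed.

End ReflectedSolution.

(** * Injectivity of the gluing data and the two parts of [Lc] *)

Section Lyapunov.
Variables (R : realType) (n : nat) (A0 A1 : 'M[R]_n) (tau : R).
Hypotheses (tau_gt0 : 0 < tau) (stable : exponentially_stable A0 A1 tau).
Local Notation T := (tau / 2).

Let T_ge0 : 0 <= T.
Proof. by rewrite divr_ge0// ltW. Qed.

(** This is the symmetric part of [Lc], its value at [c = 0]. With [Z1 = U tau] and the symmetric
    [Z2 = U 0] it is the right-hand side of the third Lyapunov equation. *)
Definition lyapunov_form (Z1 Z2 : 'M[R]_n) : 'M[R]_n :=
  Z2^T *m A0 + A0^T *m Z2 + Z1^T *m A1 + A1^T *m Z1.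

Lemma lyapunov_form_sym Z1 Z2 : (lyapunov_form Z1 Z2)^T = lyapunov_form Z1 Z2.
Proof.
rewrite /lyapunov_form !linearD /= !trmx_mul !trmxK.
by rewrite -!addrA addrCA; congr (_ + (_ + _)); rewrite addrC.
Qed.

(** By linearity [start X - start Y] meets both gluing conditions, so [defect_eq0] applies. *)
Lemma Z_ode_inj (X Y : 'M[R]_n) Z1 Z2 Y1 Y2 :
  Z_ode A0 A1 T Z1 Z2 -> Z1 0 = X -> Z2 0 = X ->
  Z_ode A0 A1 T Y1 Y2 -> Y1 0 = Y -> Y2 0 = Y ->
  (Z2 T)^T = Z2 T -> (Y2 T)^T = Y2 T ->
  lyapunov_form (Z1 T) (Z2 T) = lyapunov_form (Y1 T) (Y2 T) -> X = Y.
Proof.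
move=> dZ Z10 Z20 dY Y10 Y20 symZ symY SZY.
suff : start X - start Y = 0.
  by move/eqP; rewrite subr_eq0 => /eqP/(can_inj mxvecK)/eq_col_mx[].
apply: (defect_eq0 tau_gt0 stable).
  rewrite linearB /= (Z_ode_defect T_ge0 dZ Z10 Z20).
  by rewrite (Z_ode_defect T_ge0 dY Y10 Y20) symZ symY !subrr.
rewrite mulmxBl linearB /= (Z_ode_defect_delay T_ge0 dZ Z10 Z20).
rewrite (Z_ode_defect_delay T_ge0 dY Y10 Y20).
by move: SZY; rewrite /lyapunov_form symZ symY => ->; rewrite subrr.
Qed.

Lemma Z_sol_ode (X : 'M[R]_n) :
  [/\ Z_ode A0 A1 T (Z_sol A0 A1 tau X).1 (Z_sol A0 A1 tau X).2,
      (Z_sol A0 A1 tau X).1 0 = X &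
      (Z_sol A0 A1 tau X).2 0 = X].
Proof.
have [dZ1 dZ2 Z10 Z20] : is_Z_solution A0 A1 tau X (Z_sol A0 A1 tau X).
  (* Existence rules out the default value of [xget]. *)
  exact: (xgetPex _ (Z_solution_exists A0 A1 tau X)).
by split => //; split; exact: has_derivR_mx_deriv_on.
Qed.

Lemma LcE (c : R) (X : 'M[R]_n) :
  let Z1 := (Z_sol A0 A1 tau X).1 T in let Z2 := (Z_sol A0 A1 tau X).2 T in
  Lc A0 A1 tau c X = lyapunov_form Z1 Z2 + c *: (Z2 - Z2^T).
Proof.
move=> Z1 Z2; rewrite /Lc -/Z1 -/Z2 /lyapunov_form mulmxBr mulmxDl.
rewrite mul_mx_scalar mul_scalar_mx scalerBr.
rewrite [RHS]addrAC; congr (_ + _); rewrite [RHS]addrAC; congr (_ + _).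
by rewrite addrACA [- _ + _]addrC.
Qed.

(** Transposition fixes [W] and [lyapunov_form] but reverses the term in [c], which must therefore
    vanish. *)
Lemma Lc_eq_sym (c : R) (W X : 'M[R]_n) : c != 0 -> W^T = W ->
  let Z1 := (Z_sol A0 A1 tau X).1 T in let Z2 := (Z_sol A0 A1 tau X).2 T in
  Lc A0 A1 tau c X = - W -> Z2^T = Z2 /\ lyapunov_form Z1 Z2 = - W.
Proof.
move=> c0 Wsym Z1 Z2; rewrite LcE -/Z1 -/Z2 => LcW.
have LcWT : lyapunov_form Z1 Z2 + c *: (Z2^T - Z2) = - W.
  rewrite -[W]Wsym -[RHS](linearN trmx) /= -LcW.
  rewrite [RHS](linearD trmx) /= lyapunov_form_sym; congr (_ + _).
  by apply/matrixP => i j; rewrite !mxE.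
have symZ : Z2^T = Z2.
  have : c *: (Z2 - Z2^T) = c *: (Z2^T - Z2).
    by apply: (addrI (lyapunov_form Z1 Z2)); rewrite LcW LcWT.
  move=> /(scalerI c0)/eqP; rewrite -[Z2^T - Z2]opprB -addr_eq0 => /eqP/matrixP D0.
  apply/matrixP => i j; have := D0 i j; rewrite !mxE; lra.
by split=> //; move: LcW; rewrite symZ subrr scaler0 addr0.
Qed.

End Lyapunov.

(** * Real and imaginary parts of the Lyapunov equation, and the conclusion *)

Section RealAndImaginaryParts.
Variables (R : realType) (n : nat) (A0 A1 W : 'M[R]_n) (tau : R).
Variable U : R -> 'M[Cplx R]_n.
Hypotheses (tau_gt0 : 0 < tau) (U_sol : is_delay_lyapunov_solution A0 A1 tau W U).

Lemma lyapunov_solution0_sym : (U 0)^T = U 0.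
Proof.
have [_ _ Utr _] := U_sol.
have /Utr : - tau <= 0 <= tau by rewrite oppr_le0 !ltW.
by rewrite oppr0 => <-.
Qed.

Lemma lyapunov_form_coordinate (prj : R[i] -> R) :
  (forall x y, prj (x + y) = prj x + prj y) ->
  (forall (a : R) x, prj (a%:C%C * x) = a * prj x) ->
  lyapunov_form A0 A1 (map_mx prj (U tau : 'M[R[i]]_n))
    (map_mx prj (U 0 : 'M[R[i]]_n)) = map_mx prj (- mxC W : 'M[R[i]]_n).
Proof.
move=> prjD prjZ; have [_ _ _ ->] := U_sol.
have prj0 : prj 0 = 0 by have := prjZ 0 0; rewrite mulr0 mul0r.
have prj_sum p (f : 'I_p -> R[i]) : prj (\sum_k f k) = \sum_k prj (f k).
  exact: (big_morph prj prjD prj0).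
apply/matrixP => i j; rewrite !mxE !prjD !prj_sum.
congr (_ + _ + _ + _); apply: eq_bigr => k _; rewrite !mxE ?prjZ//.
(* The form has the transpose of [U 0] where the equation has [U 0]; symmetry at 0 reconciles
   them. *)
- have /matrixP/(_ i k) := lyapunov_solution0_sym; rewrite mxE => ->.
  by rewrite [X in _ = prj X]mulrC prjZ mulrC.
- by rewrite [X in _ = prj X]mulrC prjZ mulrC.
Qed.

End RealAndImaginaryParts.

Theorem theorem3 (R : realType) (n : nat) (tau : R) (A0 A1 W : 'M[R]_n)
    (U : R -> 'M[Cplx R]_n) (c : R)
    (tau_gt0 : 0 < tau)
    (stable : exponentially_stable A0 A1 tau)
    (W_sym : W^T = W)
    (U_sol : is_delay_lyapunov_solution A0 A1 tau W U)
    (c_neq0 : c != 0) :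
  exists X : 'M[R]_n,
    [/\ U (tau / 2) = mxC X,
        Lc A0 A1 tau c X = - W &
        forall Y : 'M[R]_n, Lc A0 A1 tau c Y = - W -> Y = X].
Proof.
have TT : tau / 2 + tau / 2 = tau by rewrite -splitr.
have T_ge0 : 0 <= tau / 2 by rewrite divr_ge0// ltW.
have reU := Re_Z_ode tau_gt0 U_sol; have imU := Im_Z_ode tau_gt0 U_sol.
have U0 := lyapunov_solution0_sym tau_gt0 U_sol.
have reS : lyapunov_form A0 A1 (Remx (U tau)) (Remx (U 0)) = - W.
  rewrite (lyapunov_form_coordinate tau_gt0 U_sol).
  - by apply/matrixP => i j; rewrite !mxE.
  - by case=> a b [p q].
  - by move=> a [p q] /=; rewrite mul0r subr0.
have imS : lyapunov_form A0 A1 (Immx (U tau)) (Immx (U 0)) = 0.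
  rewrite (lyapunov_form_coordinate tau_gt0 U_sol).
  - by apply/matrixP => i j; rewrite !mxE /= oppr0.
  - by case=> a b [p q].
  - by move=> a [p q] /=; rewrite mul0r addr0.
have reU0 : (Remx (U 0))^T = Remx (U 0) by rewrite map_trmx U0.
have imU0 : (Immx (U 0))^T = Immx (U 0) by rewrite map_trmx U0.
have zero_ode : Z_ode A0 A1 (tau / 2) (fun=> 0) (fun=> 0).
  split; apply: mx_deriv_on_everywhere => t i j.
    by rewrite trmx0 !mul0mx addr0 mxE; exact: is_derive_cst.
  by rewrite trmx0 !mul0mx subr0 oppr0 mxE; exact: is_derive_cst.
exists (Remx (U (tau / 2))).
have X1 : Remx (U (tau / 2 + 0)) = Remx (U (tau / 2)) by rewrite addr0.
have X2 : Remx (U (tau / 2 - 0)) = Remx (U (tau / 2)) by rewrite subr0.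
split.
(* As [W] is real, the imaginary part carries the data of the zero trajectory, with which it must
   coincide. *)
- have im0 : Immx (U (tau / 2)) = 0.
    apply: (Z_ode_inj tau_gt0 stable imU _ _ zero_ode) => //=.
    + by rewrite addr0.
    + by rewrite subr0.
    + by rewrite subrr.
    + by rewrite trmx0.
    + by rewrite TT subrr imS /lyapunov_form trmx0 !mul0mx !mulmx0 !addr0.
  apply: ReIm_mx_inj.
    by apply/matrixP => i j; rewrite !mxE.
  by rewrite im0; apply/matrixP => i j; rewrite !mxE.
(* By uniqueness the endpoint values in [Lc] are [Remx (U tau)] and [Remx (U 0)]; the latter is
   symmetric, so the term in [c] disappears. *)
- have [dZ Z10 Z20] := Z_sol_ode A0 A1 tau (Remx (U (tau / 2))).
  have [Z1T Z2T] := Z_ode_unique T_ge0 dZ Z10 Z20 reU X1 X2.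
  by rewrite LcE Z1T Z2T /= TT subrr reU0 subrr scaler0 addr0.
- move=> Y /(Lc_eq_sym c_neq0 W_sym)[symY SY].
  have [dZ Z10 Z20] := Z_sol_ode A0 A1 tau Y.
  apply: (Z_ode_inj tau_gt0 stable dZ Z10 Z20 reU X1 X2) => //=.
    by rewrite subrr.
  by rewrite SY TT subrr reS.
Qed.
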